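(* Let $P=(s_j)_{j\ge 0}$ be a regular power series method, let $x=(x_j)_{j\in\mathbb{N}_0}$ be a real sequence and let $L\in\mathbb{R}$. Then $x$ is $P$-statistically convergent to $L$ if and only if there exists a subset $E\subset\mathbb{N}_0$ such that $\delta_P(E)=0$ and $\lim_{j\in E^c}x_j=L$, i.e. for every $\varepsilon>0$ only finitely many $j\in E^c=\mathbb{N}_0\setminus E$ satisfy $|x_j-L|\ge\varepsilon$.
   Context: $\mathbb{N}_0$ is the set of non-negative integers. A power series method $P=(s_j)_{j\ge0}$ is a real sequence with $s_0>0$ and $s_1,s_2,\dots\ge 0$ such that the power series $s(t)=\sum_{j=0}^\infty s_jt^j$ has radius of convergence $R$ with $0<R\le\infty$. It is regular if and only if $\lim_{0<t\to R^-}\frac{s_jt^j}{s(t)}=0$ for every $j\in\mathbb{N}_0$. For $E\subset\mathbb{N}_0$, the $P$-density of $E$ is $\delta_P(E)=\lim_{0<t\to R^-}\frac{1}{s(t)}\sum_{j\in E}s_jt^j$, whenever this limit exists; ''$\delta_P(E)=c$'' means that the limit exists and equals $c$. A real sequence $(x_j)$ is $P$-statistically convergent to $L$ if for every $\varepsilon>0$, $\delta_P(\{j\in\mathbb{N}_0:|x_j-L|\ge\varepsilon\})=0$. *)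

(* Defs.v *)
From Stdlib Require Import Reals Ensembles Finite_sets ClassicalEpsilon.
From Coquelicot Require Import Coquelicot.
Open Scope R_scope.

Record power_series_method := PowerSeriesMethod {
  coef :> nat -> R;
  coef_0_pos : 0 < coef 0%nat;
  coef_ge0 : forall j : nat, (1 <= j)%nat -> 0 <= coef j;
  radius_pos : Rbar_lt 0 (CV_radius coef)
}.

(** Filter of [0 < t -> R^-], uniformly for finite and infinite [R]. *)
Definition left_to (r : Rbar) : (R -> Prop) -> Prop :=
  within (fun t : R => 0 < t /\ Rbar_lt t r) (Rbar_locally r).

Definition regular (P : power_series_method) : Prop :=
  forall j : nat,
    filterlim (fun t : R => P j * t ^ j / PSeries P t)
      (left_to (CV_radius P)) (locally 0).

Definition restrict (s : nat -> R) (E : Ensemble nat) (j : nat) : R :=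
  if excluded_middle_informative (E j) then s j else 0.

(** [is_density P E c]: the limit defining the [P]-density of [E] exists and
    equals [c]. *)
Definition is_density (P : power_series_method) (E : Ensemble nat) (c : R)
  : Prop :=
  filterlim (fun t : R => / PSeries P t * PSeries (restrict P E) t)
    (left_to (CV_radius P)) (locally c).

Definition stat_convergent (P : power_series_method) (x : nat -> R) (L : R)
  : Prop :=
  forall eps : R, 0 < eps ->
    is_density P (fun j : nat => Rabs (x j - L) >= eps) 0.

(** [lim_{j in A} x_j = L]; vacuously true when [A] is finite. *)
Definition converges_along (A : Ensemble nat) (x : nat -> R) (L : R) : Prop :=
  forall eps : R, 0 < eps ->
    Finite_sets.Finite nat (fun j : nat => A j /\ Rabs (x j - L) >= eps).

(* Main.v *)
(** Forward direction, by diagonalization: let [A k] be the set of [j] with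
    [|x j - L| >= 1/(k+1)], an increasing family of sets of density zero.
    Choose [t k -> R] such that [A k] has relative weight at most [1/(k+1)] at
    every point of [[t k, R)], and then [n k] such that the tail
    [{j | n k < j}] has relative weight at most [1/(k+1)] at every point of
    [(0, t k]].  Let [E] collect the [j] that lie in some [A k] with [k] so
    small that [n m < j] for all [m <= k].  Then [A k \ E] is finite and
    [E] is contained in the union of [A k] and [{j | n (k+1) < j}], which is
    small at every [u] with [t k <= u <= t (k+1)].  Conversely,
    [{j | |x j - L| >= eps}] is covered by [E] and a finite set, and regularity
    says that finite sets have density zero. *)
Require Import Defs.
From Stdlib Require Import Reals Ensembles Finite_sets Finite_sets_facts.
From Stdlib Require Import Classical ClassicalChoice ClassicalEpsilon Lra Lia.
From Coquelicot Require Import Coquelicot.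
Open Scope R_scope.

(** * Left neighbourhoods of the radius of convergence *)

Lemma left_toP (r : Rbar) (Q : R -> Prop) :
  Rbar_lt 0 r ->
  left_to r Q <->
  exists t : R, 0 < t /\ Rbar_lt t r /\
    forall u : R, t <= u -> Rbar_lt u r -> Q u.
Proof.
  unfold left_to, within.
  destruct r as [r| |]; simpl; intros r_pos; try easy; split.
  - intros [d Hd].
    pose proof (cond_pos d) as d_pos.
    (* [r / 2] keeps the witness positive; [r - d / 2] puts it in the ball of radius [d]. *)
    exists (Rmax (r / 2) (r - d / 2)).
    pose proof (Rmax_l (r / 2) (r - d / 2)) as le_l.
    pose proof (Rmax_r (r / 2) (r - d / 2)) as le_r.
    assert (lt_r : Rmax (r / 2) (r - d / 2) < r)
      by (apply Rmax_lub_lt; lra).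
    repeat split; [lra | exact lt_r |].
    intros u le_u u_lt; apply Hd; [|split; lra].
    apply Rabs_def1; unfold minus, plus, opp; simpl; lra.
  - intros [t [t_pos [t_lt Ht]]].
    assert (d_pos : 0 < r - t) by lra.
    exists (mkposreal _ d_pos); intros u u_ball [_ u_lt].
    apply Rabs_def2 in u_ball.
    unfold minus, plus, opp in u_ball; simpl in u_ball.
    apply Ht; lra.
  - intros [M HM].
    pose proof (Rmax_l 1 (M + 1)) as le_l.
    pose proof (Rmax_r 1 (M + 1)) as le_r.
    exists (Rmax 1 (M + 1)); repeat split; [lra|].
    intros u le_u _; apply HM; [|split; trivial]; lra.
  - intros [t [t_pos [_ Ht]]].
    exists t; intros u t_lt _; apply Ht; [lra | trivial].
Qed.

Lemma left_to_and (r : Rbar) (Q1 Q2 : R -> Prop) :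
  left_to r Q1 -> left_to r Q2 -> left_to r (fun t => Q1 t /\ Q2 t).
Proof.
  intros H1 H2; unfold left_to, within in *.
  generalize (filter_and _ _ H1 H2); apply filter_imp.
  intros t [F1 F2] Ht; split; auto.
Qed.

Lemma left_to_imp (r : Rbar) (Q1 Q2 : R -> Prop) :
  (forall t : R, 0 < t -> Rbar_lt t r -> Q1 t -> Q2 t) ->
  left_to r Q1 -> left_to r Q2.
Proof.
  intros imp; unfold left_to, within; apply filter_imp.
  intros t H1 [t_pos t_lt]; auto.
Qed.

Lemma left_to_gt (r : Rbar) (b : R) :
  Rbar_lt b r -> left_to r (fun t => b < t).
Proof.
  intros b_lt; unfold left_to, within.
  generalize (open_Rbar_gt' r b b_lt); apply filter_imp; simpl; auto.
Qed.

(** Take [r - 1/(k+1)] for finite [r] and [k] for infinite [r]. Points chosen above [b k] then tend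
    to [r]. *)
Lemma cofinal_sequence (r : Rbar) :
  Rbar_lt 0 r ->
  exists b : nat -> R, (forall k, Rbar_lt (b k) r) /\
    forall t : R, Rbar_lt t r ->
      exists K : nat, forall k, (K <= k)%nat -> t < b k.
Proof.
  destruct r as [r| |]; simpl; intros r_pos; try easy.
  - exists (fun k => r - / INR (S k)); split.
    + intros k; pose proof (RinvN_pos k) as inv_pos.
      rewrite S_INR; lra.
    + intros t t_lt.
      destruct (archimed_cor1 (r - t)) as [K [HK K_pos]]; [lra|].
      exists K; intros k K_le.
      assert (/ INR (S k) <= / INR K); [|lra].
      apply Rinv_le_contravar; [now apply lt_0_INR | apply le_INR; lia].
  - exists INR; split; [easy|].
    intros t _; destruct (INR_unbounded t) as [K HK].
    exists K; intros k K_le; apply le_INR in K_le; lra.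
Qed.

(** * Weights of sets: convergence, subadditivity, monotonicity, tails *)

Section Weights.

Variable P : power_series_method.

(** The numerator in the density quotient, left undivided so that estimates compare it with
    multiples of [total]. *)
Definition weight (E : Ensemble nat) (t : R) : R := PSeries (restrict P E) t.

Definition total : R -> R := PSeries P.

Definition inside (t : R) : Prop := 0 < t /\ Rbar_lt t (CV_radius P).

Lemma coef_nonneg (j : nat) : 0 <= P j.
Proof.
  destruct j as [|j]; [left; apply coef_0_pos | apply coef_ge0; lia].
Qed.

Lemma restrict_bounds (E : Ensemble nat) (j : nat) :
  0 <= restrict P E j <= P j.
Proof.
  pose proof (coef_nonneg j) as Pj.
  unfold restrict; destruct excluded_middle_informative; lra.
Qed.

Lemma ex_series_coef (t : R) :
  inside t -> ex_series (fun j => P j * t ^ j).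
Proof.
  intros [t_pos t_lt]; apply ex_series_Rabs.
  apply CV_disk_inside; rewrite Rabs_pos_eq; [exact t_lt | lra].
Qed.

Lemma restrict_term_bounds (E : Ensemble nat) (t : R) (j : nat) :
  0 < t -> 0 <= restrict P E j * t ^ j <= P j * t ^ j.
Proof.
  intros t_pos; destruct (restrict_bounds E j) as [ge0 le].
  pose proof (pow_lt t j t_pos) as tj; split.
  - apply Rmult_le_pos; lra.
  - apply Rmult_le_compat_r; lra.
Qed.

Lemma ex_series_restrict (E : Ensemble nat) (t : R) :
  inside t -> ex_series (fun j => restrict P E j * t ^ j).
Proof.
  intros t_in; apply (ex_series_le (V := R_CompleteNormedModule) _
           (fun j => P j * t ^ j)).
  - intros j; destruct (restrict_term_bounds E t j (proj1 t_in)) as [ge0 le].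
    unfold norm; simpl; unfold abs; simpl; rewrite Rabs_pos_eq; lra.
  - now apply ex_series_coef.
Qed.

(** Termwise comparison of nonnegative series; [F] and [G] may overlap. *)
Lemma weight_cover (E F G : Ensemble nat) (t : R) :
  inside t -> (forall j, E j -> F j \/ G j) ->
  weight E t <= weight F t + weight G t.
Proof.
  intros t_in cover; unfold weight, PSeries.
  rewrite <- Series_plus by now apply ex_series_restrict.
  apply Series_le; [|apply (ex_series_plus (V := R_NormedModule));
                     now apply ex_series_restrict].
  intros j; split; [apply restrict_term_bounds, t_in|].
  rewrite <- Rmult_plus_distr_r; apply Rmult_le_compat_r.
  - apply pow_le; left; apply t_in.
  - pose proof (coef_nonneg j) as Pj; specialize (cover j).
    unfold restrict; repeat destruct excluded_middle_informative; try lra.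
    tauto.
Qed.

Lemma weight_ge0 (E : Ensemble nat) (t : R) : inside t -> 0 <= weight E t.
Proof.
  intros t_in.
  (* Covering [E] by itself twice gives [w <= w + w], hence [0 <= w]. *)
  pose proof (weight_cover E E E t t_in (fun j Ej => or_introl Ej)); lra.
Qed.

Lemma weight_monotone (E : Ensemble nat) (t u : R) :
  inside u -> 0 < t <= u -> weight E t <= weight E u.
Proof.
  intros u_in t_le; apply Series_le; [|now apply ex_series_restrict].
  intros j; split; [now apply restrict_term_bounds|].
  apply Rmult_le_compat_l; [apply restrict_bounds | apply pow_incr; lra].
Qed.

(** The partial sums are constant from index [j] on, so [t] can be arbitrary. *)
Lemma weight_singleton (j : nat) (t : R) :
  weight (fun i => i = j) t = P j * t ^ j.
Proof.
  apply is_series_unique.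
  apply (is_series_ext (fun i => if excluded_middle_informative (i = j)
                                 then P j * t ^ j else 0)).
  - intros i; unfold restrict.
    destruct excluded_middle_informative as [->|]; lra.
  - apply filterlim_ext_loc with (f := fun _ : nat => P j * t ^ j);
      [|apply filterlim_const].
    exists j; intros n j_le; symmetry.
    assert (zero : forall m, (m < j)%nat ->
      sum_n (fun i => if excluded_middle_informative (i = j)
                      then P j * t ^ j else 0) m = 0).
    { induction m as [|m IH]; intros m_lt.
      - rewrite sum_O; destruct excluded_middle_informative; [lia | easy].
      - rewrite sum_Sn, IH by lia; unfold plus; simpl.
        destruct excluded_middle_informative; [lia | lra]. }
    induction j_le as [|n j_le IH].
    + destruct j as [|j].
      * rewrite sum_O; now destruct excluded_middle_informative.
      * rewrite sum_Sn, zero by lia; unfold plus; simpl.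
        destruct excluded_middle_informative; [lra | easy].
    + rewrite sum_Sn, IH; unfold plus; simpl.
      destruct excluded_middle_informative; [lia | lra].
Qed.

(** The term of index 0 alone gives a lower bound independent of [t]. *)
Lemma total_ge (t : R) : inside t -> P 0%nat <= total t.
Proof.
  intros t_in; replace (P 0%nat) with (P 0%nat * t ^ 0) by (simpl; ring).
  rewrite <- weight_singleton.
  apply Series_le; [|now apply ex_series_coef].
  intros j; apply restrict_term_bounds, t_in.
Qed.

Lemma total_pos (t : R) : inside t -> 0 < total t.
Proof.
  intros t_in; pose proof (coef_0_pos P); pose proof (total_ge t t_in); lra.
Qed.

(** Split both series after [n + 1] terms: the restricted head vanishes and the remainders agree. *)
Lemma weight_tail (n : nat) (t : R) :
  inside t ->
  weight (fun j => (n < j)%nat) t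
  = total t - sum_n (fun j => P j * t ^ j) n.
Proof.
  intros t_in; unfold weight, total, PSeries.
  rewrite (Series_incr_n (fun j => P j * t ^ j) (S n))
    by (try apply ex_series_coef; trivial; lia).
  rewrite (Series_incr_n (fun j => restrict P _ j * t ^ j) (S n))
    by (try apply ex_series_restrict; trivial; lia).
  simpl pred.
  rewrite sum_n_Reals, (sum_eq _ (fun _ => 0)), sum_cte.
  - rewrite Rmult_0_l, Rplus_0_l.
    assert (Series (fun k => restrict P (fun j => (n < j)%nat) (S n + k)
                             * t ^ (S n + k))
            = Series (fun k => P (S n + k)%nat * t ^ (S n + k))) as ->;
      [|ring].
    apply Series_ext; intros k; unfold restrict.
    destruct excluded_middle_informative; [easy | lia].
  - intros j j_le; unfold restrict.
    destruct excluded_middle_informative; [lia | ring].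
Qed.

Lemma weight_tail_small (t eps : R) :
  inside t -> 0 < eps ->
  exists n : nat, weight (fun j => (n < j)%nat) t <= eps.
Proof.
  intros t_in eps_pos.
  pose proof (Series_correct _ (ex_series_coef t t_in)) as lim.
  destruct (proj1 (filterlim_locally _ _) lim (mkposreal _ eps_pos))
    as [n Hn].
  exists n; rewrite weight_tail by easy.
  specialize (Hn n (Nat.le_refl n)); apply Rabs_def2 in Hn.
  change (sum_n (fun j => P j * t ^ j) n - total t < eps
          /\ - eps < sum_n (fun j => P j * t ^ j) n - total t) in Hn.
  lra.
Qed.

(** * Density zero expressed by weights *)

Lemma filterlim_left_to_0 (f : R -> R) :
  (forall t : R, inside t -> 0 <= f t) ->
  filterlim f (left_to (CV_radius P)) (locally 0) <->
  forall eps : R, 0 < eps -> left_to (CV_radius P) (fun t => f t <= eps).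
Proof.
  intros f_ge0; split.
  - intros lim eps eps_pos.
    assert (nbh : locally 0 (fun y : R => Rabs (y - 0) < eps))
      by (exists (mkposreal _ eps_pos); trivial).
    generalize (lim _ nbh); apply left_to_imp.
    intros t _ _ H; apply Rabs_def2 in H; lra.
  - intros small Q [eps HQ].
    pose proof (cond_pos eps) as eps_pos.
    (* Halving turns the non-strict bound into the strict one that the ball requires. *)
    assert (half_pos : 0 < eps / 2) by lra.
    generalize (small _ half_pos); apply left_to_imp.
    intros t t_pos t_lt H; apply HQ.
    specialize (f_ge0 t (conj t_pos t_lt)).
    apply Rabs_def1; unfold minus, plus, opp; simpl; lra.
Qed.

Lemma is_density_0P (E : Ensemble nat) :
  is_density P E 0 <->
  forall eps : R, 0 < eps ->
    left_to (CV_radius P) (fun t => weight E t <= eps * total t).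
Proof.
  assert (equiv : forall eps t, inside t ->
    / total t * weight E t <= eps <-> weight E t <= eps * total t).
  { intros eps t t_in; pose proof (total_pos t t_in) as tot.
    rewrite Rmult_comm; exact (Rle_div_l _ _ _ tot). }
  unfold is_density; rewrite filterlim_left_to_0.
  - split; intros H eps eps_pos; generalize (H eps eps_pos);
      apply left_to_imp; intros t t_pos t_lt; apply equiv; now split.
  - intros t t_in; apply Rmult_le_pos; [|now apply weight_ge0].
    left; apply Rinv_0_lt_compat, (total_pos t t_in).
Qed.

Lemma is_density_0_cover (E F G : Ensemble nat) :
  is_density P F 0 -> is_density P G 0 ->
  (forall j, E j -> F j \/ G j) -> is_density P E 0.
Proof.
  rewrite !is_density_0P; intros HF HG cover eps eps_pos.
  assert (half_pos : 0 < eps / 2) by lra.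
  generalize (left_to_and _ _ _ (HF _ half_pos) (HG _ half_pos)).
  apply left_to_imp; intros t t_pos t_lt [F_le G_le].
  pose proof (weight_cover E F G t (conj t_pos t_lt) cover); lra.
Qed.

(** Regularity is exactly density zero for singletons; covers add one point at a time. *)
Lemma is_density_0_finite (E : Ensemble nat) :
  regular P -> Finite_sets.Finite nat E -> is_density P E 0.
Proof.
  intros reg fin.
  assert (single : forall j, is_density P (fun i => i = j) 0).
  { intros j; unfold is_density.
    apply filterlim_ext with (2 := reg j); intros t.
    change (PSeries (restrict P _) t) with (weight (fun i => i = j) t).
    rewrite weight_singleton; unfold Rdiv; ring. }
  induction fin as [|A fin IH j _].
  - apply (is_density_0_cover _ _ _ (single 0%nat) (single 0%nat)).
    intros i [].
  - apply (is_density_0_cover _ _ _ IH (single j)).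
    intros i [i' HA | i' []]; auto.
Qed.

End Weights.

(** * Finite sets and crossing indices in the natural numbers *)

Lemma finite_bounded (A : Ensemble nat) (n : nat) :
  (forall j, A j -> (j < n)%nat) -> Finite_sets.Finite nat A.
Proof.
  intros bound.
  apply (Finite_downward_closed nat (fun j => (j < n)%nat));
    [|exact bound].
  clear; induction n as [|n IH].
  - assert ((fun j => (j < 0)%nat) = Empty_set nat) as ->.
    { apply Extensionality_Ensembles; split; intros j Hj;
        [inversion Hj | destruct Hj]. }
    constructor.
  - apply (Finite_downward_closed nat _ (Add_preserves_Finite _ _ n IH)).
    intros j Hj; unfold In in Hj; destruct (Nat.eq_dec j n) as [->|ne].
    + right; constructor.
    + left; unfold In; lia.
Qed.

Lemma bounded_range (n : nat -> nat) (k : nat) :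
  exists N, forall m, (m <= k)%nat -> (n m < N)%nat.
Proof.
  induction k as [|k [N HN]].
  - exists (S (n 0%nat)); intros m m_le; replace m with 0%nat; lia.
  - exists (S (N + n (S k))); intros m m_le.
    destruct (Nat.eq_dec m (S k)) as [->|ne]; [lia|].
    specialize (HN m); lia.
Qed.

(** Descending from an index where [Q] holds to [K], where it fails, must meet a switch. With [Q k]
    as [u < t k] this traps [u] between consecutive [t k] without [t] being monotone. *)
Lemma least_above (Q : nat -> Prop) (K : nat) :
  (exists k, (K <= k)%nat /\ Q (S k)) -> ~ Q K ->
  exists k, (K <= k)%nat /\ ~ Q k /\ Q (S k).
Proof.
  intros [k [K_le Qk]] nQ; revert Qk.
  induction K_le as [|k K_le IH]; intros Qk; [now exists K|].
  destruct (classic (Q (S k))) as [QS|nQS]; [now apply IH|].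
  exists (S k); split; [lia | easy].
Qed.

(** * Diagonalization over an increasing family of null sets *)

Lemma density_0_pseudo_union (P : power_series_method)
    (A : nat -> Ensemble nat) :
  (forall k l j, (k <= l)%nat -> A k j -> A l j) ->
  (forall k, is_density P (A k) 0) ->
  exists E : Ensemble nat, is_density P E 0 /\
    forall k, Finite_sets.Finite nat (fun j => A k j /\ ~ E j).
Proof.
  intros A_incr A_null.
  destruct (cofinal_sequence _ (radius_pos P)) as [b [b_lt b_cof]].
  (* The requirement [b k < t] forces the chosen points to tend to the radius. *)
  assert (ex_t : forall k, exists t, inside P t /\ b k < t /\
    forall u, t <= u -> inside P u ->
      weight P (A k) u <= / INR (S k) * total P u).
  { intros k; pose proof (proj1 (is_density_0P P (A k)) (A_null k)) as small.
    assert (inv_pos : 0 < / INR (S k))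
      by (apply Rinv_0_lt_compat, lt_0_INR; lia).
    pose proof (left_to_and _ _ _ (small _ inv_pos) (left_to_gt _ _ (b_lt k)))
      as ev.
    apply (left_toP _ _ (radius_pos P)) in ev.
    destruct ev as [t [t_pos [t_lt Ht]]]; exists t.
    split; [now split | split; [apply (Ht t (Rle_refl t) t_lt)|]].
    intros u t_le [_ u_lt]; now apply Ht. }
  apply choice in ex_t; destruct ex_t as [t Ht].
  (* Measuring the tail against [P 0] rather than [total P (t k)] makes the bound usable at every
     smaller [u], since [P 0 <= total P u]. *)
  assert (ex_n : forall k, exists n,
    weight P (fun j => (n < j)%nat) (t k) <= / INR (S k) * P 0%nat).
  { intros k; apply weight_tail_small; [apply Ht|].
    apply Rmult_lt_0_compat; [|apply coef_0_pos].
    apply Rinv_0_lt_compat, lt_0_INR; lia. }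
  apply choice in ex_n; destruct ex_n as [n Hn].
  exists (fun j => exists k, A k j /\ forall m, (m <= k)%nat -> (n m < j)%nat).
  split.
  - apply is_density_0P; intros eps eps_pos.
    (* One half of [eps] is for [A k], the other for the tail. *)
    destruct (archimed_cor1 (eps / 2)) as [K [HK K_pos]]; [lra|].
    assert (inv_le : forall k, (K <= k)%nat -> / INR (S k) <= eps / 2).
    { intros k K_le; apply Rle_trans with (/ INR K); [|lra].
      apply Rinv_le_contravar; [now apply lt_0_INR | apply le_INR; lia]. }
    apply (left_toP _ _ (radius_pos P)).
    exists (t K); destruct (Ht K) as [[tK_pos tK_lt] _].
    split; [exact tK_pos | split; [exact tK_lt|]].
    intros u tK_le u_lt.
    assert (u_in : inside P u) by (split; [lra | exact u_lt]).
    destruct (least_above (fun k => u < t k) K) as [k [K_le [t_le u_lt']]].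
    { destruct (b_cof u u_lt) as [k0 Hk0].
      exists (K + k0)%nat; split; [lia|].
      apply Rlt_trans with (b (S (K + k0))); [apply Hk0; lia | apply Ht]. }
    { lra. }
    apply Rnot_lt_le in t_le.
    eapply Rle_trans.
    { apply (weight_cover P _ (A k) (fun j => (n (S k) < j)%nat) u u_in).
      (* If [m <= k], then [A m] lies in [A k]; otherwise [k + 1 <= m], and the condition defining
         [E] gives [n (k+1) < j]. *)
      intros j [m [Amj Hm]]; destruct (Nat.le_gt_cases m k) as [m_le|k_lt].
      - left; now apply (A_incr m).
      - right; now apply Hm. }
    pose proof (total_ge P u u_in) as tot.
    pose proof (coef_0_pos P) as c0.
    assert (weight P (A k) u <= eps / 2 * total P u).
    { eapply Rle_trans; [now apply Ht|].
      apply Rmult_le_compat_r; [lra | now apply inv_le]. }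
    assert (weight P (fun j => (n (S k) < j)%nat) u <= eps / 2 * total P u).
    { eapply Rle_trans.
      { apply (weight_monotone P _ u (t (S k))); [apply Ht|].
        destruct u_in; lra. }
      eapply Rle_trans; [apply Hn|].
      apply Rmult_le_compat; [|lra|apply inv_le; lia|exact tot].
      left; apply Rinv_0_lt_compat, lt_0_INR; lia. }
    lra.
  - intros k; destruct (bounded_range n k) as [N HN].
    (* An element of [A k] that is at least [N] exceeds [n m] for all [m <= k], so it lies in
       [E]. *)
    apply (finite_bounded _ N); intros j [Akj nE].
    destruct (Nat.le_gt_cases N j) as [N_le|]; [|easy].
    exfalso; apply nE; exists k; split; [easy|].
    intros m m_le; specialize (HN m m_le); lia.
Qed.

(** * Statistical convergence as convergence off a null set *)

Theorem theorem2 (P : power_series_method) (P_regular : regular P)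
    (x : nat -> R) (L : R) :
  stat_convergent P x L <->
  exists E : Ensemble nat,
    is_density P E 0 /\ converges_along (Complement nat E) x L.
Proof.
  split.
  - intros stat.
    destruct (density_0_pseudo_union P
      (fun k j => Rabs (x j - L) >= / INR (S k))) as [E [E_null E_fin]].
    + intros k l j k_le ge; apply Rge_trans with (1 := ge), Rle_ge.
      apply Rinv_le_contravar; [apply lt_0_INR; lia | apply le_INR; lia].
    + intros k; apply stat, Rinv_0_lt_compat, lt_0_INR; lia.
    + exists E; split; [exact E_null|].
      intros eps eps_pos.
      destruct (archimed_cor1 eps eps_pos) as [k [Hk k_pos]].
      (* The set of index [pred k] has threshold [1/k], which is below [eps]; [k > 0] makes the
         shift exact. *)
      apply (Finite_downward_closed nat _ (E_fin (pred k))).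
      intros j [nE ge]; split; [|exact nE].
      replace (S (pred k)) with k by lia; lra.
  - intros [E [E_null conv]] eps eps_pos.
    apply (is_density_0_cover P _ E _ E_null
             (is_density_0_finite P _ P_regular (conv eps eps_pos))).
    intros j ge; destruct (classic (E j)); [now left | right; now split].
Qed.
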